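(* Let $K$ be a field, $n\ge 1$, and let $\mathcal M$ be a $K$-subspace of $\operatorname{Mat}_n(K)$ such that $\operatorname{tr}M=0$ for all $M\in\mathcal M$. Consider the statements: (1) $\operatorname{char}K=0$ or $\operatorname{char}K\ge n+1$; (2) ($\operatorname{char}K=0$ or $\operatorname{char}K\ge n$) and $I_n\notin\mathcal M$; (3) every element of $\mathfrak r(\mathcal M)$ is nilpotent; (4) $\mathcal M$ is a two-sided Mathieu subspace of $\operatorname{Mat}_n(K)$. Then (1) $\Rightarrow$ (2) $\Rightarrow$ (3) $\Rightarrow$ (4).
   Context: $\operatorname{Mat}_n(K)$ is the $K$-algebra of $n\times n$ matrices over $K$ and $I_n$ is the identity matrix. A $K$-subspace $\mathcal M$ of $\operatorname{Mat}_n(K)$ is a two-sided Mathieu subspace if for all $a,b,c\in\operatorname{Mat}_n(K)$ such that $a^m\in\mathcal M$ for all $m\ge 1$, one has $ba^mc\in\mathcal M$ for all sufficiently large $m$. The radical of a subset $S\subseteq\operatorname{Mat}_n(K)$ is $\mathfrak r(S)=\{a\in\operatorname{Mat}_n(K)\mid a^m\in S\text{ for all sufficiently large }m\}$. *)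

(* Defs.v *)
From mathcomp Require Import all_boot all_order all_algebra.

Set Implicit Arguments.
Unset Strict Implicit.
Unset Printing Implicit Defensive.

Import GRing.Theory.
Local Open Scope ring_scope.

(* [pchar K] contains at most one prime, so the disjuncts read
   char K = 0 and char K >= m respectively. *)
Definition char0_or_ge (K : fieldType) (m : nat) : Prop :=
  [pchar K] =i pred0 \/ exists2 p : nat, p \in [pchar K] & (m <= p)%N.

Definition nilpotent_mx (K : fieldType) (n : nat) (a : 'M[K]_n) : Prop :=
  exists m : nat, a ^+ m = 0.

Definition mx_radical (K : fieldType) (n : nat) (S : {pred 'M[K]_n})
    (a : 'M[K]_n) : Prop :=
  exists N : nat, forall m : nat, (N <= m)%N -> a ^+ m \in S.

(* Mat_n(K) is finite-dimensional, so {vspace 'M[K]_n} covers all its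
   K-subspaces. *)
Definition two_sided_mathieu (K : fieldType) (n : nat)
    (M : {vspace 'M[K]_n}) : Prop :=
  forall a b c : 'M[K]_n,
    (forall m : nat, (1 <= m)%N -> a ^+ m \in M) ->
    exists N : nat, forall m : nat, (N <= m)%N -> b *m a ^+ m *m c \in M.

(* Main.v *)
Require Import Defs.
From mathcomp Require Import all_boot all_order all_algebra.

Set Implicit Arguments.
Unset Strict Implicit.
Unset Printing Implicit Defensive.

Import GRing.Theory.
Local Open Scope ring_scope.

(** (1) => (2) holds because tr I_n = n is nonzero in K.  For (2) => (3), the
    Fitting idempotent e of a is a combination of arbitrarily high powers of a,
    hence lies in M, and tr e = rank e in K.  So the rank of e is 0 or n, that
    is, e = 0 (and a is nilpotent) or e = I_n (which is excluded).
    For (3) => (4), if a^m is in M for all m >= 1 then a^m = 0 for large m. *)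

Lemma char0_or_ge_leq (K : fieldType) (m n : nat) :
  (m <= n)%N -> char0_or_ge K n -> char0_or_ge K m.
Proof.
move=> le_mn [K0 | [p pK le_np]]; first by left.
by right; exists p => //; apply: leq_trans le_np.
Qed.

Lemma char0_or_ge_natr_eq0 (K : fieldType) (m r : nat) :
  char0_or_ge K m -> (r < m)%N -> (r%:R == 0 :> K) = (r == 0)%N.
Proof.
case=> [/pcharf0P-> // | [p pK le_mp] lt_rm].
rewrite -(dvdn_pcharf pK); case: r lt_rm => [|r] lt_rm; first by rewrite dvdn0.
by rewrite gtnNdvd // (leq_trans lt_rm).
Qed.

(** In the rank factorization e = CR, cancelling the full-rank outer factors from CRCR = CR leaves
    RC = 1, of size [\rank e]; and tr(CR) = tr(RC). *)
Lemma mxtrace_idem (K : fieldType) (n : nat) (e : 'M[K]_n) :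
  e *m e = e -> \tr e = (\rank e)%:R.
Proof.
move=> ee; have CR := mulmx_base e.
suff RC : row_base e *m col_base e = 1%:M by rewrite -{1}CR mxtrace_mulC RC mxtrace1.
apply: (row_free_inj (row_base_free e)); apply: (row_full_inj (col_base_full e)) => /=.
by rewrite mul1mx CR mulmxA mulmxA CR -mulmxA CR ee.
Qed.

(** Split the characteristic polynomial as [g * 'X^k] with g(0) nonzero. By Bezout,
    [u * 'X^L + v * g = 1], and [e] projects onto the part where [a] is invertible, along the part
    where it is nilpotent. *)
Lemma fitting_idempotent (K : fieldType) (n : nat) (a : 'M[K]_n.+1) (N : nat) :
  exists u : {poly K}, exists2 L : nat, (N <= L)%N &
    let e := horner_mx a (u * 'X^L) in e * e = e /\ (e = 0 -> a ^+ L = 0).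
Proof.
have pn0 : char_poly a != 0 by rewrite monic_neq0 ?char_poly_monic.
have [k [g g0 Dp]] := multiplicity_XsubC (char_poly a) 0.
rewrite pn0 /= in g0; rewrite subr0 in Dp.
(* [k <= L] makes [g * 'X^L] a multiple of the characteristic polynomial, so it vanishes at [a]. *)
pose L := maxn N k.
have co : coprimep ('X^L) g.
  by rewrite coprimep_expl // coprimep_sym -['X]subr0 -polyC0 coprimep_XsubC.
have [[u v] /= uv] := Bezout_eq1_coprimepP _ _ co.
have gL : horner_mx a (g * 'X^L) = 0.
  rewrite -(subnKC (leq_maxr N k : (k <= L)%N)) exprD mulrA -Dp rmorphM /=.
  by rewrite Cayley_Hamilton mul0r.
exists u, L; first exact: leq_maxl.
split=> [|e0].
  (* With its second factor rewritten as [1 - v * g], the square is [e] minus a multiple of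
     [g * 'X^L] at [a]. *)
  rewrite -rmorphM /= -[X in _ * X](addrK (v * g)) uv mulrBr mulr1 rmorphB /=.
  have -> : u * 'X^L * (v * g) = u * v * (g * 'X^L).
    by rewrite -!mulrA; congr (_ * _); rewrite mulrC -mulrA.
  by rewrite [X in _ - X]rmorphM /= gL mulr0 subr0.
have -> : a ^+ L = horner_mx a ('X^L * (u * 'X^L + v * g)).
  by rewrite uv mulr1 rmorphXn /= horner_mx_X.
have -> : 'X^L * (u * 'X^L + v * g) = 'X^L * (u * 'X^L) + v * (g * 'X^L).
  by rewrite mulrDr; congr (_ + _); rewrite mulrC mulrA.
move: (u * 'X^L) e0 (g * 'X^L) gL => p p0 q q0.
by rewrite rmorphD !rmorphM /= p0 q0 !mulr0 addr0.
Qed.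

Lemma horner_mx_high_powers (K : fieldType) (n : nat) (M : {vspace 'M[K]_n.+1})
    (a : 'M[K]_n.+1) (u : {poly K}) (L : nat) :
  (forall m : nat, (L <= m)%N -> a ^+ m \in M) -> horner_mx a (u * 'X^L) \in M.
Proof.
move=> aM; rewrite -[u]coefK poly_def mulr_suml rmorph_sum /=.
apply: rpred_sum => i _.
rewrite -scalerAl -exprD linearZ /= rmorphXn /= horner_mx_X.
by rewrite memvZ // aM // leq_addl.
Qed.

Theorem lemma1p3 (K : fieldType) (n : nat) (hn : (1 <= n)%N)
    (M : {vspace 'M[K]_n}) (htr : forall A : 'M[K]_n, A \in M -> \tr A = 0) :
  (char0_or_ge K n.+1 -> char0_or_ge K n /\ 1%:M \notin M) /\
  (char0_or_ge K n /\ 1%:M \notin M ->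
     forall a : 'M[K]_n, mx_radical M a -> nilpotent_mx a) /\
  ((forall a : 'M[K]_n, mx_radical M a -> nilpotent_mx a) ->
     two_sided_mathieu M).
Proof.
case: n hn M htr => // n _ M htr; split; [|split].
- move=> hK; split; first exact: char0_or_ge_leq hK.
  apply/negP=> /htr/eqP.
  by rewrite mxtrace1 (char0_or_ge_natr_eq0 hK).
- move=> [hK nM1] a [N aM].
  have [u [L le_NL [ee e0]]] := fitting_idempotent a N.
  have eM : horner_mx a (u * 'X^L) \in M.
    by apply: horner_mx_high_powers => m /(leq_trans le_NL)/aM.
  exists L; apply: e0; set e := horner_mx a _ in ee eM *.
  have /eqP := htr e eM; rewrite (mxtrace_idem ee).
  (* An idempotent of full rank is invertible, hence the identity; a smaller rank is zero in [K]
     only if it is 0. *)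
  have := rank_leq_row e; rewrite leq_eqVlt => /predU1P[re | lt_r].
    have ue : e \is a GRing.unit by rewrite -[_ \is a _]row_free_unit /row_free re.
    by case/negP: nM1; rewrite -[1%:M]/(1 : 'M_n.+1) -(mulrV ue) -{1}ee mulrK.
  by rewrite (char0_or_ge_natr_eq0 hK lt_r) mxrank_eq0 => /eqP.
- move=> nil a b c aM; have [N aN0] : nilpotent_mx a by apply: nil; exists 1%N.
  exists N => m le_Nm.
  by rewrite -(subnKC le_Nm) exprD aN0 mul0r mulmx0 mul0mx mem0v.
Qed.
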